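(* Let $X, Y$ be Banach spaces, let $T\in C(X,Y)$, and let $T^+\in D(Y,X)$ be a generalized inverse of $T$. Let $\delta T\colon D(\delta T)\to D(T^+)$ be a linear operator, with $D(\delta T)\subset X$ a linear subspace, such that $D(T)\subset D(\delta T)$ and $\delta T$ is $T$-bounded with constants $a,b>0$, where $b<1$. Put $\bar T=T+\delta T\in C(X,Y)$. Then the following statements are equivalent: (1) $I_Y+\delta T\,T^+\colon D(T^+)\to D(T^+)$ is bijective; (2) $T^+\bar T\big|_{R(T^+)}=(I_X+T^+\delta T)\big|_{R(T^+)}\colon R(T^+)\to R(T^+)$ is bijective; (3) $D(T^+)=\bar T R(T^+)+N(T^+)$, $\bar T R(T^+)\cap N(T^+)=\{0\}$ and $N(\bar T)\cap R(T^+)=\{0\}$.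
   Context: Operators are linear and may be unbounded; $D(A)$, $R(A)$, $N(A)$ denote the domain, range and null space of an operator $A$, and $I_X$, $I_Y$ are identity operators. $D(X,Y)$ denotes the set of densely defined linear operators from $X$ to $Y$ (domain a dense linear subspace of $X$), and $C(X,Y)$ the set of closed densely defined linear operators from $X$ to $Y$. For $T\in C(X,Y)$, a generalized inverse of $T$, denoted $T^+$, is an operator $S\in D(Y,X)$ with $D(S)\supset R(T)$, $R(S)\subset D(T)$, $TST=T$ on $D(T)$ and $STS=S$ on $D(S)$. The operator $\delta T$ with $D(T)\subset D(\delta T)$ is $T$-bounded with constants $a,b>0$ if $\|\delta T x\|\le a\|x\|+b\|Tx\|$ for all $x\in D(T)$. The operator $\bar T=T+\delta T$ has domain $D(T)$; when $\delta T$ is $T$-bounded with $b<1$ it is known that $\bar T\in C(X,Y)$. $\bar T R(T^+)$ denotes the image of $R(T^+)$ under $\bar T$. *)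

(* Defs.v *)
From mathcomp Require Import all_boot all_order all_algebra.
From mathcomp Require Import all_classical all_reals all_analysis.

Set Implicit Arguments.
Unset Strict Implicit.
Unset Printing Implicit Defensive.

Import Order.TTheory GRing.Theory Num.Theory.
Import numFieldNormedType.Exports.
Local Open Scope classical_set_scope.
Local Open Scope ring_scope.

(* A linear operator defined on a linear subspace [op_dom] of X. The underlying
   function is total, but its values outside [op_dom] carry no information:
   every notion below only looks at it on [op_dom]. *)
Record operator (K : numFieldType) (X Y : lmodType K) := Operator {
  op_dom : set X ;
  op_fun :> X -> Y ;
  op_dom_submod : submod_closed [in op_dom] ;
  op_linear : forall (k : K) (x y : X), op_dom x -> op_dom y ->
    op_fun (k *: x + y) = k *: op_fun x + op_fun y
}.

Section Algebra.
Context {K : numFieldType}.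
Implicit Types X Y Z : lmodType K.

Definition op_range X Y (T : operator X Y) : set Y := T @` op_dom T.

Definition op_kernel X Y (T : operator X Y) : set X :=
  [set x | op_dom T x /\ T x = 0].

Lemma op_id_submod X : submod_closed [in [set: X]].
Proof. by split=> [|k x y _ _]; rewrite inE. Qed.

Definition op_id X : operator X X :=
  Operator (op_id_submod X) (fun k x y _ _ => erefl (k *: x + y)).

Lemma op_add_submod X Y (S T : operator X Y) :
  submod_closed [in op_dom S `&` op_dom T].
Proof.
have [S0 SD] := op_dom_submod S; have [T0 TD] := op_dom_submod T.
split=> [|k x y]; first by rewrite inE; split; apply/set_mem.
rewrite !inE => -[Sx Tx] [Sy Ty].
by split; apply/set_mem; [apply: SD|apply: TD]; apply/mem_set.
Qed.

Lemma op_add_linear X Y (S T : operator X Y) (k : K) (x y : X) :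
  (op_dom S `&` op_dom T) x -> (op_dom S `&` op_dom T) y ->
  S (k *: x + y) + T (k *: x + y) = k *: (S x + T x) + (S y + T y).
Proof.
by move=> [Sx Tx] [Sy Ty]; rewrite !op_linear// scalerDr addrACA.
Qed.

(* D(S + T) is the intersection of D(S) and D(T). *)
Definition op_add X Y (S T : operator X Y) : operator X Y :=
  @Operator K X Y (op_dom S `&` op_dom T) (fun x => S x + T x)
    (op_add_submod S T) (@op_add_linear X Y S T).

Lemma op_dom_add X Y (S T : operator X Y) :
  op_dom S `<=` op_dom T -> op_dom (op_add S T) = op_dom S.
Proof. exact: setIidl. Qed.

Lemma op_comp_submod X Y Z (S : operator Y Z) (T : operator X Y) :
  submod_closed [in [set x | op_dom T x /\ op_dom S (T x)]].
Proof.
have [S0 SD] := op_dom_submod S; have [T0 TD] := op_dom_submod T.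
have T00 : T 0 = 0.
  have := op_linear 1 (set_mem T0) (set_mem T0).
  by rewrite !scale1r addr0 => /eqP; rewrite -subr_eq0 opprD addNKr oppr_eq0 => /eqP.
split=> [|k x y]; first by rewrite inE /= T00; split; apply/set_mem.
rewrite !inE => -[Tx STx] [Ty STy].
split; first by apply/set_mem/TD; apply/mem_set.
by rewrite op_linear//; apply/set_mem/SD; apply/mem_set.
Qed.

Lemma op_comp_linear X Y Z (S : operator Y Z) (T : operator X Y)
    (k : K) (x y : X) :
  [set x | op_dom T x /\ op_dom S (T x)] x ->
  [set x | op_dom T x /\ op_dom S (T x)] y ->
  S (T (k *: x + y)) = k *: S (T x) + S (T y).
Proof. by move=> [Tx STx] [Ty STy]; rewrite !op_linear. Qed.

Definition op_comp X Y Z (S : operator Y Z) (T : operator X Y) : operator X Z :=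
  @Operator K X Z [set x | op_dom T x /\ op_dom S (T x)] (fun x => S (T x))
    (op_comp_submod S T) (@op_comp_linear X Y Z S T).

(* S|_A = T|_A, both operators being defined on all of A. *)
Definition op_agree_on X Y (A : set X) (S T : operator X Y) : Prop :=
  [/\ A `<=` op_dom S, A `<=` op_dom T & forall x, A x -> S x = T x].

(* T|_A is a bijection of A onto B, T being defined on all of A. *)
Definition op_bijective_on X Y (T : operator X Y) (A : set X) (B : set Y) : Prop :=
  A `<=` op_dom T /\ set_bij A B T.

End Algebra.

Section Topology.
Context {K : numFieldType}.
Implicit Types X Y : normedModType K.

Definition densely_defined X Y (T : operator X Y) : Prop := dense (op_dom T).

Definition closed_operator X Y (T : operator X Y) : Prop :=
  closed [set p : X * Y | op_dom T p.1 /\ p.2 = T p.1].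

Definition closed_densely_defined X Y (T : operator X Y) : Prop :=
  closed_operator T /\ densely_defined T.

Definition generalized_inverse X Y (T : operator X Y) (S : operator Y X) :
    Prop :=
  [/\ densely_defined S,
      op_range T `<=` op_dom S,
      op_range S `<=` op_dom T,
      op_agree_on (op_dom T) (op_comp T (op_comp S T)) T &
      op_agree_on (op_dom S) (op_comp S (op_comp T S)) S].

Definition relatively_bounded X Y (a b : K) (T dT : operator X Y) : Prop :=
  op_dom T `<=` op_dom dT /\
  forall x, op_dom T x -> `|dT x| <= a * `|x| + b * `|T x|.

End Topology.

(* Main.v *)
Require Import Defs.
From mathcomp Require Import all_boot all_order all_algebra.
From mathcomp Require Import all_classical all_reals all_analysis.
From mathcomp Require Import ring.
Import Order.TTheory GRing.Theory Num.Theory.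
Import numFieldNormedType.Exports.
Local Open Scope classical_set_scope.
Local Open Scope ring_scope.

(** The operator [A = I + dT Tp] on [D(Tp)] and the operator [B = Tp Tbar] on
    [R(Tp)] are intertwined by [Tp]: [Tp A = B Tp].  Moreover
    [D(Tp) = T R(Tp) + N(Tp)] is a direct sum, [A] is the identity on [N(Tp)]
    and [A (T x) = Tbar x] for [x] in [R(Tp)].  Statement (3) says exactly that
    [A], read in this decomposition, is bijective.

    Closedness of [Tbar]: since [b < 1], [(1 - b) |T x| <= |Tbar x| + a |x|],
    so a filter on [D(T)] along which both [x] and [Tbar x] converge makes
    [T x] Cauchy, hence convergent; closedness of [T] then applies. *)

(** * Algebra of linear operators on their domains and ranges *)

Section OperatorAlgebra.
Context {K : numFieldType} {X Y : lmodType K} (T : operator X Y).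

Lemma op_dom0 : op_dom T 0.
Proof. by have [/set_mem] := op_dom_submod T. Qed.

Lemma op_domB (x y : X) : op_dom T x -> op_dom T y -> op_dom T (x - y).
Proof.
move=> Tx Ty; have [_ TD] := op_dom_submod T.
by apply/set_mem; rewrite addrC -scaleN1r; apply: TD; apply/mem_set.
Qed.

Lemma op_domN (x : X) : op_dom T x -> op_dom T (- x).
Proof. by rewrite -sub0r; apply: op_domB; exact: op_dom0. Qed.

Lemma op_domD (x y : X) : op_dom T x -> op_dom T y -> op_dom T (x + y).
Proof. by move=> Tx Ty; rewrite -(opprK y); apply/op_domB/op_domN. Qed.

Lemma opB (x y : X) : op_dom T x -> op_dom T y -> T (x - y) = T x - T y.
Proof. by move=> Tx Ty; rewrite addrC -scaleN1r op_linear// scaleN1r addrC. Qed.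

Lemma op0 : T 0 = 0.
Proof. by rewrite -(subrr 0) opB ?subrr//; exact: op_dom0. Qed.

Lemma opD (x y : X) : op_dom T x -> op_dom T y -> T (x + y) = T x + T y.
Proof. by move=> Tx Ty; rewrite -{1}(scale1r x) op_linear// scale1r. Qed.

(** Equal values put the difference of the arguments in the kernel. Stability of [A] under
    differences is phrased on plain sets, so that domains and ranges both qualify. *)
Lemma op_inj_on (A : set X) : A `<=` op_dom T ->
    (forall x y, A x -> A y -> A (x - y)) ->
    (forall x, A x -> T x = 0 -> x = 0) -> set_inj A T.
Proof.
move=> AT AB T0 x y /set_mem Ax /set_mem Ay Txy.
apply/subr0_eq/T0; first exact: AB.
by rewrite opB ?Txy ?subrr//; exact: AT.
Qed.

Lemma op_rangeB (x y : Y) : op_range T x -> op_range T y -> op_range T (x - y).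
Proof.
move=> [u Tu <-] [v Tv <-]; exists (u - v); first exact: op_domB.
exact: opB.
Qed.

Lemma op_range0 : op_range T 0.
Proof. by exists 0; [exact: op_dom0 | exact: op0]. Qed.

End OperatorAlgebra.

(** * Stability of closedness under relatively bounded perturbations *)

Section RelativelyBounded.
Context {K : numFieldType} {X : normedModType K} {Y : completeNormedModType K}.
Implicit Types (T dT : operator X Y) (a b : K).

(** Write [T x] as [(T x + dT x) - dT x] and move the [b]-term of the bound on [dT x] to the left.
    For [b < 1] this controls [T] by the graph norm of [T + dT]. *)
Lemma relatively_bounded_add T dT a b (x : X) :
  relatively_bounded a b T dT -> op_dom T x ->
  (1 - b) * `|T x| <= `|op_add T dT x| + a * `|x|.
Proof.
move=> [_ dTb] Tx; rewrite mulrBl mul1r lerBlDr -addrA.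
apply: le_trans (lerD (lexx _) (dTb _ Tx)).
by rewrite -{1}(addrK (dT x) (T x)) ler_normB.
Qed.

Lemma closed_operator_add T dT a b :
  closed_operator T -> 0 < a -> 0 < b -> b < 1 ->
  relatively_bounded a b T dT -> closed_operator (op_add T dT).
Proof.
move=> Tclosed a0 b0 b1 dTb; have [domT dTle] := dTb.
have b1' : 0 < 1 - b by rewrite subr_gt0.
rewrite /closed_operator closure_id; apply/seteqP; split.
  exact: subset_closure.
rewrite closureEcvg => -[x y] [F PF [Fxy FG]].
have FTbar : \forall p \near F, op_dom T p.1 /\ p.2 = op_add T dT p.1.
  by apply: FG => p [[]].
have cvg1 : p.1 @[p --> F] --> x
  by apply: cvg_trans (cvg_app _ Fxy) _; exact: cvg_fst.
have cvg2 : p.2 @[p --> F] --> y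
  by apply: cvg_trans (cvg_app _ Fxy) _; exact: cvg_snd.
have [z Tz] : exists z : Y, T p.1 @[p --> F] --> z.
  apply/cvg_ex; apply: cauchy_cvg; apply: cauchy_exP => e e0.
  (* Two points within [d] of the limit are within [2d] of each other, in both coordinates; [d]
     solves [(1 - b) * e = 2d + a * 2d], the bound that the previous lemma then gives. *)
  pose d := (1 - b) * e / (2 * (1 + a)).
  have d0 : 0 < d by rewrite divr_gt0 ?mulr_gt0 // addr_gt0.
  have near_d : \forall p \near F, [/\ op_dom T p.1, p.2 = op_add T dT p.1,
      `|x - p.1| < d & `|y - p.2| < d].
    move/cvgrPdist_lt/(_ d d0) : cvg1 => nx.
    move/cvgrPdist_lt/(_ d d0) : cvg2 => ny.
    by near=> p; split; [| |exact: (near nx p)|exact: (near ny p)];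
      have [] : op_dom T p.1 /\ p.2 = op_add T dT p.1 by near: p.
  have [p0 [Tp0 p0E xp0 yp0]] := filter_ex near_d.
  exists (T p0.1); apply: filterS near_d => p [Tp pE xp yp].
  rewrite -ball_normE /= -opB//.
  rewrite -(ltr_pM2l b1').
  have Tpp0 := op_domB T _ _ Tp0 Tp.
  apply: le_lt_trans (relatively_bounded_add _ _ _ _ _ dTb Tpp0) _.
  have -> : (1 - b) * e = (d + d) + a * (d + d).
    by rewrite /d; field; rewrite gt_eqF// addr_gt0.
  have dist_lt (V : normedModType K) (w u v : V) :
      `|w - u| < d -> `|w - v| < d -> `|u - v| < d + d.
    move=> wu wv; rewrite -(subrKA w).
    by apply: le_lt_trans (ler_normD _ _) (ltrD _ _) => //; rewrite distrC.
  have domA u : op_dom T u -> op_dom (op_add T dT) u by split => //; exact: domT.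
  rewrite ltrD ?ltr_pM2l//; last exact: dist_lt xp0 xp.
  by rewrite (opB (op_add T dT)) -?p0E -?pE; [exact: dist_lt yp0 yp|exact: domA..].
(* Closedness of [T] is applied along [F] to the pairs [(p.1, T p.1)], which tend to [(x, z)]. *)
have [Tx Txz] : op_dom T x /\ z = T x.
  have gT : \forall p \near F,
      [set q : X * Y | op_dom T q.1 /\ q.2 = T q.1] (p.1, T p.1).
    by apply: filterS FTbar => p [].
  have xzG := @closed_cvg _ _ F PF (fun p => (p.1, T p.1)) _ Tclosed gT (x, z).
  by apply: xzG; exact: cvg_pair cvg1 Tz.
split => /=; first by split => //; exact: domT.
(* By uniqueness of limits it is enough that [p.2] also tends to [T x + dT x]. *)
apply: (cvg_unique (@norm_hausdorff _ _)) cvg2 _.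
apply/cvgrPdist_lt => e e0.
(* At [x - p.1] the operator [T] contributes less than [d] and [dT] less than [a * d + b * d]; the
   sum is [e]. *)
pose d := e / (1 + b + a).
have ab0 : 0 < 1 + b + a by rewrite !addr_gt0.
have d0 : 0 < d by rewrite divr_gt0.
move/cvgrPdist_lt/(_ d d0) : cvg1 => nx.
move/cvgrPdist_lt/(_ d d0) : Tz => nz.
near=> p.
have [Tp pE] : op_dom T p.1 /\ p.2 = op_add T dT p.1 by near: p.
have xp : `|x - p.1| < d by exact: (near nx p).
have zp : `|z - T p.1| < d by exact: (near nz p).
have Txp : op_dom T (x - p.1) by exact: op_domB.
rewrite pE -(opB (op_add T dT)); [|by split => //; exact: domT..].
apply: le_lt_trans (ler_normD _ _) _.
apply: le_lt_trans (lerD (lexx _) (dTle _ Txp)) _.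
rewrite opB// -Txz.
have -> : e = d + (a * d + b * d) by rewrite /d; field; rewrite gt_eqF.
by rewrite !ltrD// ltr_pM2l.
Unshelve. all: by end_near.
Qed.

End RelativelyBounded.

Theorem theorem3p1 (K : numFieldType) (X Y : completeNormedModType K)
    (T : operator X Y) (Tp : operator Y X) (dT : operator X Y) (a b : K)
    (T_closed : closed_densely_defined T)
    (Tp_ginv : generalized_inverse T Tp)
    (dT_range : op_range dT `<=` op_dom Tp)
    (a_gt0 : 0 < a) (b_gt0 : 0 < b) (b_lt1 : b < 1)
    (dT_bounded : relatively_bounded a b T dT) :
  let Tbar := op_add T dT in
  let TbarR := Tbar @` op_range Tp in
  [/\ closed_densely_defined Tbar,
      op_agree_on (op_range Tp) (op_comp Tp Tbar) (op_add (op_id X) (op_comp Tp dT)) &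
      [<-> op_bijective_on (op_add (op_id Y) (op_comp dT Tp)) (op_dom Tp) (op_dom Tp);
           op_bijective_on (op_comp Tp Tbar) (op_range Tp) (op_range Tp);
           [/\ op_dom Tp = [set u + v | u in TbarR & v in op_kernel Tp],
               TbarR `&` op_kernel Tp = [set 0] &
               op_kernel Tbar `&` op_range Tp = [set 0]]]].
Proof.
move=> Tbar TbarR.
have [_ RT_dom RTp_dom [_ _ TTpT] [_ _ TpTTp]] := Tp_ginv.
have [domT _] := dT_bounded.
have dom_Tbar : op_dom Tbar = op_dom T by exact: op_dom_add.
have R_Tbar x : op_range Tp x -> op_dom Tbar x.
  by move=> /RTp_dom; rewrite dom_Tbar.
have T_D x : op_dom T x -> op_dom Tp (T x) by move=> Tx; apply: RT_dom; exists x.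
have dT_D x : op_dom T x -> op_dom Tp (dT x).
  by move=> /domT Tx; apply: dT_range; exists x.
have Tbar_D x : op_dom T x -> op_dom Tp (Tbar x).
  by move=> Tx; apply: op_domD; [exact: T_D | exact: dT_D].
have Tp_R y : op_dom Tp y -> op_range Tp (Tp y) by exists y.
have Tp_T y : op_dom Tp y -> op_dom T (Tp y) by move=> /Tp_R/RTp_dom.
have TpT x : op_range Tp x -> Tp (T x) = x.
  by move=> [y yD <-]; exact: TpTTp.
have TpTbar x : op_range Tp x -> Tp (Tbar x) = x + Tp (dT x).
  move=> xR; have Tx := RTp_dom _ xR.
  by rewrite /Tbar /= opD ?TpT//; [exact: T_D | exact: dT_D].
pose A : operator Y Y := op_add (op_id Y) (op_comp dT Tp).
have A_dom : op_dom Tp `<=` op_dom A.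
  by move=> y yD; split => //; split => //; exact/domT/Tp_T.
have B_dom : op_range Tp `<=` op_dom (op_comp Tp Tbar).
  by move=> x xR; split; [exact: R_Tbar | exact/Tbar_D/RTp_dom].
have A_D y : op_dom Tp y -> op_dom Tp (A y).
  by move=> yD; apply: op_domD => //; exact/dT_D/Tp_T.
have TpA y : op_dom Tp y -> Tp (A y) = Tp (Tbar (Tp y)).
  move=> yD; rewrite TpTbar; last exact: Tp_R.
  by rewrite [LHS]opD//; exact/dT_D/Tp_T.
have AT x : op_range Tp x -> A (T x) = Tbar x by move=> xR; rewrite /A /= TpT.
have A_ker y : op_dom Tp y -> Tp y = 0 -> A y = y.
  by move=> yD Tpy; rewrite /A /= Tpy op0 addr0.
split.
- case: T_closed => Tcl Tdense; split.
    exact: closed_operator_add Tcl a_gt0 b_gt0 b_lt1 dT_bounded.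
  by rewrite /densely_defined dom_Tbar.
- split=> // x xR; have Tx := RTp_dom _ xR.
  by split => //; split; [exact: domT | exact: dT_D].
tfae.

(* From (1) to (2), through the intertwining relation [TpA] *)
- move=> [_ [_ Ainj Asurj]]; split => //; split.
  + by move=> x xR; exact/Tp_R/Tbar_D/RTp_dom.
  + apply: op_inj_on => //; first exact: op_rangeB.
    move=> x xR /= Bx0; have Tx := RTp_dom _ xR.
    (* Both sides have image [Tbar x] under [A]: the left one by [AT], the right one because
       [Tbar x] lies in the kernel of [Tp]. *)
    have TxE : T x = Tbar x.
      apply: Ainj; [exact/mem_set/T_D | exact/mem_set/Tbar_D |].
      by rewrite -/A AT// A_ker//; exact: Tbar_D.
    by rewrite -(TpT _ xR) TxE.
  + move=> _ [y /Asurj [w wD <-] <-]; exists (Tp w); first exact: Tp_R.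
    by rewrite -/A TpA.

(* From (2) to (3) *)
- move=> [_ [_ Binj Bsurj]].
  have B0 x : op_range Tp x -> Tp (Tbar x) = 0 -> x = 0.
    move=> xR Bx0; apply: Binj; [exact: mem_set | apply/mem_set/op_range0 |].
    by rewrite /= -/Tbar [LHS]Bx0 !op0 addr0 op0.
  split.
  + apply/seteqP; split => [y yD | _ [_ [x xR <-] [v [vD _] <-]]]; last first.
      by apply: op_domD => //; exact/Tbar_D/RTp_dom.
    (* Solving [Tp (Tbar x) = Tp y] makes [y - Tbar x] the kernel component of [y]. *)
    have [x xR xE] := Bsurj _ (Tp_R _ yD).
    have xD := Tbar_D _ (RTp_dom _ xR).
    exists (Tbar x); first by exists x.
    exists (y - Tbar x); last by rewrite addrC subrK.
    split; first exact: op_domB.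
    by rewrite opB// -xE subrr.
  + apply/seteqP; split => [_ [[x xR <-] [_ /B0-/(_ xR)->]] | _ ->].
      exact: op0.
    split; first by exists 0; [exact: op_range0 | exact: op0].
    by split; [exact: op_dom0 | exact: op0].
  + apply/seteqP; split => [x [[_ Tx0] xR] | _ ->].
      by apply: B0 => //; rewrite [Tbar x]Tx0 op0.
    split; last exact: op_range0.
    by split; [exact: op_dom0 | exact: op0].

(* From (3) to (1), through the splitting [y = T (Tp y) + (y - T (Tp y))] *)
- move=> [DE TbarN kerR].
  have split_D y : op_dom Tp y -> op_kernel Tp (y - T (Tp y)).
    move=> yD; have TD := T_D _ (Tp_T _ yD); split; first exact: op_domB.
    by rewrite opB// TpT ?subrr//; exact: Tp_R.
  split => //; split.
  + by move=> y; exact: A_D.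
  + apply: op_inj_on => //; first by move=> x y; exact: op_domB.
    rewrite -/A => y yD Ay0.
    have xR := Tp_R _ yD.
    have [nD Tpn0] := split_D _ yD.
    have TD := T_D _ (Tp_T _ yD).
    (* [A] sends the first summand of [y] to [Tbar (Tp y)] and fixes the second, so [A y = 0] places
       [Tbar (Tp y)] in both [TbarR] and the kernel of [Tp]. *)
    have AyE : Tbar (Tp y) = - (y - T (Tp y)).
      apply/eqP; rewrite -addr_eq0 -AT// -(A_ker (y - T (Tp y)))//.
      by rewrite -opD ?subrKC ?Ay0 //; exact: A_dom.
    have Tbar0 : Tbar (Tp y) = 0.
      suff : (TbarR `&` op_kernel Tp) (Tbar (Tp y)) by rewrite TbarN.
      split; first by exists (Tp y).
      rewrite AyE; split; first exact: op_domN.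
      by rewrite -sub0r opB ?op0 ?Tpn0 ?subrr//; exact: op_dom0.
    have Tpy0 : Tp y = 0.
      suff : (op_kernel Tbar `&` op_range Tp) (Tp y) by rewrite kerR.
      by split=> //; split=> //; exact: R_Tbar.
    by rewrite -(A_ker y).
  + move=> y; rewrite {1}DE => -[_ [x xR <-] [v [vD v0] <-]].
    have TD := T_D _ (RTp_dom _ xR).
    (* [A] maps [T x] to [Tbar x] and fixes [v], so this is a preimage of [Tbar x + v]. *)
    exists (T x + v); first exact: op_domD.
    rewrite -/A opD; [|exact: A_dom..].
    by rewrite AT// A_ker.
Qed.
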